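(* Let $R$ be a commutative Noetherian ring and let $A$ be a projective Noetherian $R$-algebra. Let $Q\in A\text{-mod}\cap R\text{-proj}$ be such that $\operatorname{Hom}_A(Q,Q)\in R\text{-proj}$, and let $B=\operatorname{End}_A(Q)^{op}$. For $M\in A\text{-mod}\cap R\text{-proj}$ let $\chi_M\colon Q\otimes_B\operatorname{Hom}_A(Q,M)\to M$ be the $A$-homomorphism $q\otimes g\mapsto g(q)$. Then for every $M\in A\text{-mod}\cap R\text{-proj}$: (i) $\chi_M$ is surjective if and only if $DQ\text{-}\operatorname{domdim}_{(A,R)}DM\geq 1$; (ii) $\chi_M$ is an isomorphism if and only if $DQ\text{-}\operatorname{domdim}_{(A,R)}DM\geq 2$.
   Context: A projective Noetherian $R$-algebra is an $R$-algebra that is finitely generated and projective as an $R$-module. $A\text{-mod}$ is the category of finitely generated left $A$-modules, $R\text{-proj}$ is the category of finitely generated projective $R$-modules, and $D=\operatorname{Hom}_R(-,R)$, which sends left $A$-modules to right $A$-modules (left $A^{op}$-modules) and conversely. For a module $T$, $\operatorname{add}T$ is the full subcategory of direct summands of finite direct sums of copies of $T$. $Q$ is a right $B$-module and $\operatorname{Hom}_A(Q,M)$ is a left $B$-module in the natural way. An exact sequence of $A$-modules is $(A,R)$-exact if it splits as a sequence of $R$-modules; an $(A,R)$-monomorphism is an $A$-homomorphism $f\colon M\to N$ such that $0\to M\xrightarrow{f}N$ is $(A,R)$-exact (i.e. $f$ is split injective over $R$). A left $\operatorname{add}T$-approximation of $X$ is an $A$-homomorphism $X\to N$ with $N\in\operatorname{add}T$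 such that $\operatorname{Hom}_A(N,Y)\to\operatorname{Hom}_A(X,Y)$ is surjective for all $Y\in\operatorname{add}T$. Relative dominant dimension: for $T,X\in A\text{-mod}\cap R\text{-proj}$, if $X$ admits no left $\operatorname{add}T$-approximation which is an $(A,R)$-monomorphism then $T\text{-}\operatorname{domdim}_{(A,R)}X=0$. Otherwise $T\text{-}\operatorname{domdim}_{(A,R)}X\in\mathbb N\cup\{+\infty\}$ is the supremum of all $n\in\mathbb N$ such that there is an $(A,R)$-exact sequence $0\to X\to T_1\to\cdots\to T_n$ with all $T_i\in\operatorname{add}T$ which remains exact under $\operatorname{Hom}_A(-,T)$, i.e. $\operatorname{Hom}_A(T_n,T)\to\cdots\to\operatorname{Hom}_A(T_1,T)\to\operatorname{Hom}_A(X,T)\to 0$ is exact. The same definition is used for right modules; in the claim $DQ$ and $DM$ are right $A$-modules. *)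

(* Defs.v *)
From HB Require Import structures.
From mathcomp Require Import all_boot all_order all_algebra.
From mathcomp Require Import ring_quotient.
From mathcomp Require Import boolp classical_sets constructive_ereal.
From mathcomp Require Import freeg.

Set Implicit Arguments.
Unset Strict Implicit.
Unset Printing Implicit Defensive.

Import GRing.Theory.

Local Open Scope ring_scope.
Local Open Scope quotient_scope.

(* An R-algebra is a ring A with a ring morphism from R to the center of A; in
   contrast with algType R, the zero ring is allowed. *)
HB.mixin Record PzRing_isPzAlgebra (R : comPzRingType) A of GRing.PzRing A := {
  alg_map : {rmorphism R -> A};
  alg_mapC : forall (r : R) (a : A), alg_map r * a = a * alg_map r
}.

#[short(type="pzAlgType")]
HB.structure Definition PzAlgebra (R : comPzRingType) :=
  {A of GRing.PzRing A & PzRing_isPzAlgebra R A}.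

(* Right A-modules are left modules over the converse ring A^c. *)
Section ConverseAlgebra.
Variables (R : comPzRingType) (A : pzAlgType R).

Definition alg_map_conv (r : R) : A^c := @alg_map R A r.

Fact alg_map_conv_zmod_morphism : zmod_morphism alg_map_conv.
Proof. by move=> r s; rewrite /alg_map_conv rmorphB. Qed.

Fact alg_map_conv_monoid_morphism : monoid_morphism alg_map_conv.
Proof.
by split=> [|r s]; rewrite /alg_map_conv ?rmorph1 // mulrC rmorphM.
Qed.

HB.instance Definition _ :=
  GRing.isZmodMorphism.Build R A^c alg_map_conv alg_map_conv_zmod_morphism.
HB.instance Definition _ :=
  GRing.isMonoidMorphism.Build R A^c alg_map_conv alg_map_conv_monoid_morphism.

Fact alg_map_convC (r : R) (a : A^c) : alg_map_conv r * a = a * alg_map_conv r.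
Proof. by rewrite /alg_map_conv [LHS](esym (@alg_mapC R A r a)). Qed.

HB.instance Definition _ := PzRing_isPzAlgebra.Build R A^c alg_map_convC.
End ConverseAlgebra.

Section ScalarRestriction.
Variables (R : comPzRingType) (A : pzAlgType R).

Lemma scale_algC (M : lmodType A) (r : R) (a : A) (x : M) :
  a *: (@alg_map R A r *: x) = @alg_map R A r *: (a *: x).
Proof. by rewrite !scalerA alg_mapC. Qed.

(* The R-module underlying an A-module. *)
Definition restr (M : lmodType A) : Type := M.

Variable M : lmodType A.

HB.instance Definition _ := GRing.Zmodule.on (restr M).

Let rscale (r : R) (x : restr M) : restr M := @alg_map R A r *: (x : M).

Fact rscaleA r s x : rscale r (rscale s x) = rscale (r * s) x.
Proof. by rewrite /rscale scalerA rmorphM. Qed.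
Fact rscale1 : left_id 1 rscale.
Proof. by move=> x; rewrite /rscale rmorph1 scale1r. Qed.
Fact rscaleDr : right_distributive rscale +%R.
Proof. by move=> r x y; rewrite /rscale scalerDr. Qed.
Fact rscaleDl x : {morph rscale^~ x : r s / r + s}.
Proof. by move=> r s; rewrite /rscale rmorphD scalerDl. Qed.

HB.instance Definition _ := @GRing.Zmodule_isLmodule.Build R (restr M)
  rscale rscaleA rscale1 rscaleDr rscaleDl.
End ScalarRestriction.

Section LinearZmodule.
Variables (S : pzRingType) (M N : lmodType S).
Implicit Types f g h : {linear M -> N}.

Lemma linear_ext f g : f =1 g -> f = g.
Proof.
case: f g => [f [[fa] [fs]]] [g [[ga] [gs]]] /= /funext fg; subst g.
by rewrite (Prop_irrelevance fa ga) (Prop_irrelevance fs gs).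
Qed.

HB.instance Definition _ := gen_eqMixin {linear M -> N}.
HB.instance Definition _ := gen_choiceMixin {linear M -> N}.

Let ladd f g : {linear M -> N} := f \+ g.
Let lopp f : {linear M -> N} := \- f.
Let lzero : {linear M -> N} := \0.

Fact laddA : associative ladd.
Proof. by move=> f g h; apply: linear_ext => x /=; rewrite addrA. Qed.
Fact laddC : commutative ladd.
Proof. by move=> f g; apply: linear_ext => x /=; rewrite addrC. Qed.
Fact ladd0 : left_id lzero ladd.
Proof. by move=> f; apply: linear_ext => x /=; rewrite add0r. Qed.
Fact laddN : left_inverse lzero lopp ladd.
Proof. by move=> f; apply: linear_ext => x /=; rewrite addNr. Qed.

HB.instance Definition _ :=
  GRing.isZmodule.Build {linear M -> N} laddA laddC ladd0 laddN.
End LinearZmodule.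

Section HomModule.
Variables (R : comPzRingType) (A : pzAlgType R) (M N : lmodType A).

(* Hom_A(M, N) as an R-module. *)
Definition homR : Type := {linear M -> N}.

HB.instance Definition _ := GRing.Zmodule.on homR.

Section Scale.
Variables (r : R) (f : {linear M -> N}).
Definition hom_scale_fun (x : M) : N := @alg_map R A r *: f x.
Fact hom_scale_linear : linear hom_scale_fun.
Proof.
by move=> a x y; rewrite /hom_scale_fun linearP scalerDr scale_algC.
Qed.
HB.instance Definition _ :=
  GRing.isLinear.Build A M N *:%R hom_scale_fun hom_scale_linear.
Definition hom_scale : homR := hom_scale_fun.
End Scale.

Fact hom_scaleA r s (f : homR) :
  hom_scale r (hom_scale s f) = hom_scale (r * s) f.
Proof.
by apply: linear_ext => x /=; rewrite /hom_scale_fun rmorphM scalerA.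
Qed.
Fact hom_scale1 : left_id 1 hom_scale.
Proof.
by move=> f; apply: linear_ext => x /=; rewrite /hom_scale_fun rmorph1 scale1r.
Qed.
Fact hom_scaleDr : right_distributive hom_scale +%R.
Proof.
by move=> r f g; apply: linear_ext => x /=; rewrite /hom_scale_fun scalerDr.
Qed.
Fact hom_scaleDl (f : homR) : {morph hom_scale^~ f : r s / r + s}.
Proof.
by move=> r s; apply: linear_ext => x /=; rewrite /hom_scale_fun rmorphD scalerDl.
Qed.

HB.instance Definition _ := @GRing.Zmodule_isLmodule.Build R homR
  hom_scale hom_scaleA hom_scale1 hom_scaleDr hom_scaleDl.
End HomModule.

(* D M = Hom_R(M, R), a right A-module through (f a)(x) = f (a x). *)
Section Dual.
Variables (R : comPzRingType) (A : pzAlgType R) (M : lmodType A).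

Definition dual : Type := {linear restr M -> R^o}.

HB.instance Definition _ := GRing.Zmodule.on dual.

Section Scale.
Variables (a : A) (f : {linear restr M -> R^o}).
Definition dual_scale_fun (x : restr M) : R^o := f (a *: (x : M)).
Fact dual_scale_linear : linear dual_scale_fun.
Proof.
move=> r x y; rewrite /dual_scale_fun -linearP; congr (f _).
by rewrite [LHS]scalerDr; congr (_ + _); exact: scale_algC.
Qed.
HB.instance Definition _ :=
  GRing.isLinear.Build R (restr M) R^o *:%R dual_scale_fun dual_scale_linear.
Definition dual_scale : dual := dual_scale_fun.
End Scale.

Fact dual_scaleA (a b : A^c) (f : dual) :
  dual_scale a (dual_scale b f) = dual_scale (a * b) f.
Proof.
by apply: linear_ext => x /=; rewrite /dual_scale_fun /= /dual_scale_fun scalerA.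
Qed.
Fact dual_scale1 : left_id (1 : A^c) dual_scale.
Proof.
by move=> f; apply: linear_ext => x /=; rewrite /dual_scale_fun scale1r.
Qed.
Fact dual_scaleDr : right_distributive dual_scale +%R.
Proof. by move=> a f g; apply: linear_ext. Qed.
Fact dual_scaleDl (f : dual) : {morph dual_scale^~ f : a b / a + b}.
Proof.
move=> a b; apply: linear_ext => x /=; rewrite /dual_scale_fun scalerDl.
exact: linearD.
Qed.

HB.instance Definition _ := @GRing.Zmodule_isLmodule.Build A^c dual
  dual_scale dual_scaleA dual_scale1 dual_scaleDr dual_scaleDl.
End Dual.

Section EndomorphismRing.
Variables (S : pzRingType) (Q : lmodType S).

Definition endo : Type := {linear Q -> Q}.

HB.instance Definition _ := GRing.Zmodule.on endo.

Let emul (f g : endo) : endo :=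
  ((f : {linear Q -> Q}) \o (g : {linear Q -> Q}) : {linear Q -> Q}).
Let eone : endo := (idfun : {linear Q -> Q}).

Fact emulA : associative emul.
Proof. by move=> f g h; apply: linear_ext. Qed.
Fact emul1l : left_id eone emul.
Proof. by move=> f; apply: linear_ext. Qed.
Fact emul1r : right_id eone emul.
Proof. by move=> f; apply: linear_ext. Qed.
Fact emulDl : left_distributive emul +%R.
Proof. by move=> f g h; apply: linear_ext. Qed.
Fact emulDr : right_distributive emul +%R.
Proof. by move=> f g h; apply: linear_ext => x; exact: linearD. Qed.

HB.instance Definition _ :=
  GRing.Zmodule_isPzRing.Build endo emulA emul1l emul1r emulDl emulDr.

Definition end_op : pzRingType := endo^c.

(* Q as a right End(Q)^op-module: q b = b(q). *)
Definition end_right : Type := Q.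

HB.instance Definition _ := GRing.Zmodule.on end_right.

Let ract (b : end_op^c) (q : end_right) : end_right := (b : {linear Q -> Q}) q.

Fact ractA a b q : ract a (ract b q) = ract (a * b) q.
Proof. by []. Qed.
Fact ract1 : left_id 1 ract.
Proof. by []. Qed.
Fact ractDr : right_distributive ract +%R.
Proof. by move=> b x y; exact: linearD. Qed.
Fact ractDl q : {morph ract^~ q : a b / a + b}.
Proof. by []. Qed.

HB.instance Definition _ := @GRing.Zmodule_isLmodule.Build end_op^c end_right
  ract ractA ract1 ractDr ractDl.

(* Hom(Q, M) as a left End(Q)^op-module: b g = g \o b. *)
Variable M : lmodType S.
Definition hom_end : Type := {linear Q -> M}.

HB.instance Definition _ := GRing.Zmodule.on hom_end.

Let lact (b : end_op) (g : hom_end) : hom_end :=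
  ((g : {linear Q -> M}) \o (b : {linear Q -> Q}) : {linear Q -> M}).

Fact lactA a b g : lact a (lact b g) = lact (a * b) g.
Proof. by apply: linear_ext. Qed.
Fact lact1 : left_id 1 lact.
Proof. by move=> g; apply: linear_ext. Qed.
Fact lactDr : right_distributive lact +%R.
Proof. by move=> b f g; apply: linear_ext. Qed.
Fact lactDl g : {morph lact^~ g : a b / a + b}.
Proof. by move=> a b; apply: linear_ext => x; exact: linearD. Qed.

HB.instance Definition _ := @GRing.Zmodule_isLmodule.Build end_op hom_end
  lact lactA lact1 lactDr lactDl.
End EndomorphismRing.

(* Tensor product of a right and a left B-module: the free abelian group on
   P * N modulo the subgroup generated by the biadditivity and balancing
   relations. *)
Section Tensor.
Variables (B : pzRingType) (P : lmodType B^c) (N : lmodType B).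

Local Notation free := {freeg (P * N)%type / int}.
Local Notation gen p n := (Freeg [:: (1%:Z, (p, n))] : free).

Inductive tensor_null : free -> Prop :=
| tensor_null0 : tensor_null 0
| tensor_nullB x y : tensor_null x -> tensor_null y -> tensor_null (x - y)
| tensor_nullDl p p' n : tensor_null (gen (p + p') n - (gen p n + gen p' n))
| tensor_nullDr p n n' : tensor_null (gen p (n + n') - (gen p n + gen p n'))
| tensor_nullZ p (b : B) n :
    tensor_null (gen ((b : B^c) *: p) n - gen p (b *: n)).

Definition tensor_rel : {pred free} := fun x => `[< tensor_null x >].

Fact tensor_rel_zmod_closed : zmod_closed tensor_rel.
Proof.
split; first by apply/asboolP; exact: tensor_null0.
by move=> x y /asboolP ? /asboolP ?; apply/asboolP; exact: tensor_nullB.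
Qed.

HB.instance Definition _ :=
  GRing.isZmodClosed.Build free tensor_rel tensor_rel_zmod_closed.

Definition tensor : Type := Quotient.quot tensor_rel.

HB.instance Definition _ := GRing.Zmodule.on tensor.

Definition pure (p : P) (n : N) : tensor := \pi_(Quotient.quot tensor_rel) (gen p n).

Lemma pure_eq p n p' n' q m : tensor_null (gen p n - (gen p' n' + gen q m)) ->
  pure p n = pure p' n' + pure q m.
Proof.
move=> h; rewrite /pure -raddfD; apply/eqP.
by rewrite -[_ == _](@Quotient.idealrBE _ tensor_rel); apply/asboolP.
Qed.

Lemma pureDl p p' n : pure (p + p') n = pure p n + pure p' n.
Proof. exact/pure_eq/tensor_nullDl. Qed.

Lemma pureDr p n n' : pure p (n + n') = pure p n + pure p n'.
Proof. exact/pure_eq/tensor_nullDr. Qed.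

Lemma pureZ p (b : B) n : pure ((b : B^c) *: p) n = pure p (b *: n).
Proof.
apply/eqP; rewrite -[_ == _](@Quotient.idealrBE _ tensor_rel).
by apply/asboolP; exact: tensor_nullZ.
Qed.

Definition balanced (G : zmodType) (phi : P -> N -> G) : Prop :=
  [/\ forall p p' n, phi (p + p') n = phi p n + phi p' n,
      forall p n n', phi p (n + n') = phi p n + phi p n' &
      forall p (b : B) n, phi ((b : B^c) *: p) n = phi p (b *: n)].

Definition flift (G : zmodType) (phi : P -> N -> G) (x : free) : G :=
  fglift (fun x : P * N => phi x.1 x.2 : zmodule G) x.

HB.instance Definition _ (G : zmodType) (phi : P -> N -> G) :=
  GRing.isZmodMorphism.Build free G (flift phi)
    (lift_is_additive (fun x : P * N => phi x.1 x.2 : zmodule G)).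

(* The map sending p (x) n to phi p n; it is a well-defined additive map only
   when phi is balanced. *)
Definition tensor_lift (G : zmodType) (phi : P -> N -> G) (t : tensor) : G :=
  flift phi (repr (t : Quotient.quot tensor_rel)).

Section Lift.
Variables (G : zmodType) (phi : P -> N -> G).
Hypothesis phiB : balanced phi.

Lemma flift_gen p n : flift phi (gen p n) = phi p n.
Proof. by rewrite /flift liftU scale1r. Qed.

Lemma flift_null x : tensor_null x -> flift phi x = 0.
Proof.
have [hl hr hz] := phiB.
elim=> [|y z _ hy _ hz'|p p' n|p n n'|p b n].
- exact: raddf0.
- by rewrite raddfB /= hy hz' subrr.
- by rewrite raddfB raddfD /= !flift_gen hl subrr.
- by rewrite raddfB raddfD /= !flift_gen hr subrr.
- by rewrite raddfB /= !flift_gen hz subrr.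
Qed.

Lemma tensor_lift_pi (x : free) :
  tensor_lift phi (\pi_(Quotient.quot tensor_rel) x) = flift phi x.
Proof.
apply/eqP; rewrite -subr_eq0 /tensor_lift -raddfB /=; apply/eqP/flift_null.
apply/asboolP; rewrite -[asbool _]/(_ \in (tensor_rel : {pred free})).
by rewrite (@Quotient.idealrBE _ tensor_rel) reprK.
Qed.

Lemma tensor_lift_pure p n : tensor_lift phi (pure p n) = phi p n.
Proof. by rewrite /pure tensor_lift_pi flift_gen. Qed.

Lemma tensor_lift_zmod_morphism : zmod_morphism (tensor_lift phi).
Proof.
move=> x y; rewrite -[x](@reprK _ (Quotient.quot tensor_rel)).
rewrite -[y](@reprK _ (Quotient.quot tensor_rel)) -raddfB.
by rewrite !tensor_lift_pi raddfB.
Qed.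
End Lift.

Lemma tensor_ind (K : tensor -> Prop) :
    K 0 -> (forall x y, K x -> K y -> K (x - y)) ->
    (forall p n, K (pure p n)) -> forall t, K t.
Proof.
move=> K0 KB Kp t.
have KN x : K x -> K (- x) by move=> /(KB _ _ K0); rewrite sub0r.
have KD x y : K x -> K y -> K (x + y).
  by move=> Kx /KN Ky; rewrite -[y]opprK; exact: KB.
rewrite -[t](@reprK _ (Quotient.quot tensor_rel)).
rewrite -[repr _]freeg_sumE raddf_sum /=.
elim/big_ind: _ => // -[p n] _; move: (coeff _ _) => m.
rewrite -[m]intz -freegU_mulz raddfMz /=.
have KM k : K (pure p n *+ k) by elim: k => // k ?; rewrite mulrS; exact: KD.
by case: m => k; [exact: KM | exact/KN/KM].
Qed.
End Tensor.

(* Q (x)_B Hom(Q, M) as a left S-module, s (q (x) g) = (s q) (x) g, and the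
   evaluation map q (x) g |-> g q, where B = End(Q)^op. *)
Section Evaluation.
Variables (S : pzRingType) (Q M : lmodType S).

Local Notation B := (end_op Q).
Local Notation QB := (end_right Q).
Local Notation HQM := (hom_end Q M).

Definition tensor_hom : Type := tensor QB HQM.

HB.instance Definition _ := GRing.Zmodule.on tensor_hom.

Let act_fun (s : S) (q : QB) (g : HQM) : tensor_hom :=
  pure (s *: (q : Q) : QB) g.

Fact act_fun_balanced s : balanced (act_fun s).
Proof.
split=> [q q' g|q g g'|q b g]; rewrite /act_fun.
- rewrite [LHS](_ : _ = pure ((s *: (q : Q) : QB) + (s *: (q' : Q) : QB)) g).
    exact: pureDl.
  by congr (pure _ _); exact: (@scalerDr S Q).
- exact: pureDr.
- rewrite -pureZ; congr (pure _ _); symmetry.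
  exact: (@linearZ_LR S Q Q *:%R (b : {linear Q -> Q})).
Qed.

Definition tensor_hom_scale (s : S) (t : tensor_hom) : tensor_hom :=
  tensor_lift (act_fun s) t.

Lemma tensor_hom_scaleB s (t u : tensor_hom) :
  tensor_hom_scale s (t - u) = tensor_hom_scale s t - tensor_hom_scale s u.
Proof. exact: (tensor_lift_zmod_morphism (act_fun_balanced s)). Qed.

Lemma tensor_hom_scale0 s : tensor_hom_scale s 0 = 0.
Proof. by rewrite -[X in tensor_hom_scale s X](subrr 0) tensor_hom_scaleB subrr. Qed.

Lemma tensor_hom_scale_pure s (q : QB) (g : HQM) :
  tensor_hom_scale s (pure q g) = pure (s *: (q : Q) : QB) g.
Proof. exact: (tensor_lift_pure (act_fun_balanced s)). Qed.

Fact tensor_hom_scaleA s s' t :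
  tensor_hom_scale s (tensor_hom_scale s' t) = tensor_hom_scale (s * s') t.
Proof.
elim/tensor_ind: t => [|t u ht hu|q g].
- by rewrite !tensor_hom_scale0.
- by rewrite !tensor_hom_scaleB ht hu.
- by rewrite !tensor_hom_scale_pure scalerA.
Qed.

Fact tensor_hom_scale1 : left_id 1 tensor_hom_scale.
Proof.
move=> t; elim/tensor_ind: t => [|t u ht hu|q g].
- by rewrite !tensor_hom_scale0.
- by rewrite !tensor_hom_scaleB ht hu.
- by rewrite !tensor_hom_scale_pure scale1r.
Qed.

Fact tensor_hom_scaleDr : right_distributive tensor_hom_scale +%R.
Proof.
move=> s t u; rewrite -[u in LHS]opprK tensor_hom_scaleB.
by rewrite -[- u in LHS]sub0r tensor_hom_scaleB tensor_hom_scale0 sub0r opprK.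
Qed.

Fact tensor_hom_scaleDl t : {morph tensor_hom_scale^~ t : s s' / s + s'}.
Proof.
move=> s s'; elim/tensor_ind: t => [|t u ht hu|q g].
- by rewrite !tensor_hom_scale0 addr0.
- by rewrite !tensor_hom_scaleB ht hu opprD addrACA.
- rewrite !tensor_hom_scale_pure -pureDl; congr (pure _ _).
  exact: (@scalerDl S Q).
Qed.

HB.instance Definition _ := @GRing.Zmodule_isLmodule.Build S tensor_hom
  tensor_hom_scale tensor_hom_scaleA tensor_hom_scale1 tensor_hom_scaleDr
  tensor_hom_scaleDl.

Let eval_fun (q : QB) (g : HQM) : M := (g : {linear Q -> M}) q.

Fact eval_fun_balanced : balanced eval_fun.
Proof. by split=> // q q' g; exact: (linearD (g : {linear Q -> M})). Qed.

Definition chi (t : tensor_hom) : M := tensor_lift eval_fun t.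

Fact chi_linear : linear chi.
Proof.
have chiB := tensor_lift_zmod_morphism eval_fun_balanced.
have chi0 : chi 0 = 0 by rewrite -[X in chi X](subrr 0) [LHS]chiB subrr.
have chiD t u : chi (t + u) = chi t + chi u.
  rewrite -[u in LHS]opprK [LHS]chiB; congr (_ + _).
  by rewrite -[- u]sub0r [X in - X]chiB -/(chi 0) chi0 sub0r opprK.
move=> s t u; rewrite chiD; congr (_ + _).
elim/tensor_ind: t => [|t v ht hv|q g].
- by rewrite scaler0 chi0 scaler0.
- by rewrite scalerBr [LHS]chiB [chi (t - v)]chiB scalerBr -ht -hv.
- rewrite [s *: _]tensor_hom_scale_pure /chi.
  rewrite !(tensor_lift_pure eval_fun_balanced).
  exact: (@linearZ_LR S Q M *:%R (g : {linear Q -> M})).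
Qed.

HB.instance Definition _ := GRing.isLinear.Build S tensor_hom M *:%R chi chi_linear.

Lemma chi_pure (q : QB) (g : HQM) : chi (pure q g) = (g : {linear Q -> M}) q.
Proof. exact: (tensor_lift_pure eval_fun_balanced). Qed.
End Evaluation.

Arguments chi {S} Q M t.

Definition fin_gen (S : pzRingType) (M : lmodType S) : Prop :=
  exists (n : nat) (v : 'I_n -> M),
    forall x, exists a : 'I_n -> S, x = \sum_i a i *: v i.

Definition surj (X Y : Type) (f : X -> Y) : Prop :=
  forall y, exists x, f x = y.

Definition projective (S : pzRingType) (P : lmodType S) : Prop :=
  forall (M N : lmodType S) (p : {linear M -> N}) (f : {linear P -> N}),
    surj p -> exists g : {linear P -> M}, forall x, p (g x) = f x.

Definition fg_proj (S : pzRingType) (P : lmodType S) : Prop :=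
  fin_gen P /\ projective P.

Definition is_ideal (R : comPzRingType) (I : set R) : Prop :=
  [/\ I 0, forall x y, I x -> I y -> I (x + y) & forall r x, I x -> I (r * x)].

Definition noetherian (R : comPzRingType) : Prop :=
  forall I : set R, is_ideal I ->
    exists (n : nat) (v : 'I_n -> R),
      forall x, I x <-> exists a : 'I_n -> R, x = \sum_i a i * v i.

Definition lin_iso (S : pzRingType) (M N : lmodType S) (f : {linear M -> N}) :
    Prop :=
  exists g : {linear N -> M}, cancel f g /\ cancel g f.

Definition in_add (S : pzRingType) (T X : lmodType S) : Prop :=
  exists (k : nat) (i : {linear X -> {ffun 'I_k -> T}})
    (p : {linear {ffun 'I_k -> T} -> X}), cancel i p.

Definition left_add_approx (S : pzRingType) (T X N : lmodType S)
    (f : {linear X -> N}) : Prop :=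
  in_add T N /\
  forall Y : lmodType S, in_add T Y -> forall g : {linear X -> Y},
    exists h : {linear N -> Y}, forall x, h (f x) = g x.

Section DominantDimension.
Variables (R : comPzRingType) (A : pzAlgType R).

Definition rel_mono (M N : lmodType A) (f : {linear M -> N}) : Prop :=
  exists s : {linear restr N -> restr M}, forall x, s (f x) = x.

(* A sequence 0 -> C 0 -> C 1 -> ... -> C n is encoded by infinite families of
   which only the C i with i <= n and the d i with i < n are constrained; exactness
   at C n is not required. *)
Section Sequence.
Variables (n : nat) (C : nat -> lmodType A).
Variable d : forall i, {linear C i -> C i.+1}.

Definition seq_exact : Prop :=
  ((0 < n)%N -> injective (d 0)) /\
  forall i, (i.+1 < n)%N ->
    forall x : C i.+1, d i.+1 x = 0 <-> exists y : C i, d i y = x.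

(* An exact sequence splits over R when the kernel and the image of each of its
   maps are R-direct summands. *)
Definition seq_split : Prop :=
  forall i, (i < n)%N ->
    exists s : {linear restr (C i.+1) -> restr (C i)},
      forall x : C i, d i (s (d i x)) = d i x.

Definition rel_exact : Prop := seq_exact /\ seq_split.

(* Exactness of Hom(C n, T) -> ... -> Hom(C 1, T) -> Hom(C 0, T) -> 0. *)
Definition hom_exact (T : lmodType A) : Prop :=
  ((0 < n)%N -> forall g : {linear C 0 -> T},
     exists h : {linear C 1 -> T}, forall x, h (d 0 x) = g x) /\
  forall i, (i.+1 < n)%N -> forall g : {linear C i.+1 -> T},
    (forall x, g (d i x) = 0) <->
    (exists h : {linear C i.+2 -> T}, forall x, h (d i.+1 x) = g x).
End Sequence.

Definition coaug (X : lmodType A) (T_ : nat -> lmodType A) (i : nat) :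
    lmodType A :=
  if i is j.+1 then T_ j else X.

Definition has_add_coresolution (T X : lmodType A) (n : nat) : Prop :=
  exists (T_ : nat -> lmodType A)
    (d : forall i, {linear coaug X T_ i -> coaug X T_ i.+1}),
    [/\ forall i, (i < n)%N -> in_add T (T_ i), rel_exact n d & hom_exact n d T].

(* Valued in {0, 1, 2, ...} together with +oo, seen inside \bar int. The index
   n = 0 imposes no condition and does not affect the supremum. *)
Definition domdim (T X : lmodType A) : \bar int :=
  if `[< exists (N : lmodType A) (f : {linear X -> N}),
           left_add_approx T f /\ rel_mono f >]
  then supremum 0%E [set n%:Z%:E | n in has_add_coresolution T X]%classic
  else 0%E.
End DominantDimension.

(* Main.v *)
Require Import Defs.
From HB Require Import structures.
From mathcomp Require Import all_boot all_order all_algebra.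
From mathcomp Require Import boolp classical_sets constructive_ereal.
From mathcomp Require Import freeg ring_quotient.

Set Implicit Arguments.
Unset Strict Implicit.
Unset Printing Implicit Defensive.

Import Order.TTheory GRing.Theory Num.Theory.

Local Open Scope ring_scope.
Local Open Scope quotient_scope.

(** Write [D M] for the [R]-dual of [M]. Over modules which are finitely generated
    projective over [R], [D] is a duality: a linear map [D N -> D M] of right
    [A]-modules is [dual_map h] for some [h : M -> N] ([dual_full]), and
    [D (Q^n)] is [(D Q)^n], so that [add (D Q)] consists of the direct summands of
    the [D (Q^n)]. Conditions on sequences in [add (D Q)] starting at [D M] thus
    become conditions on maps between powers of [Q] ending at [M].

    As [R] is noetherian, the maps from [Q] to [M] are generated over [R] by
    finitely many, which assemble into [G : Q^n -> M] through which each map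
    [Q -> M] factors ([ker_right_approx], with the zero map out of [M]). Every
    element of the tensor product is then [sum_j x_j (x) G_j] for some [x] in [Q^n],
    where [G_j] is the restriction of [G] to the [j]-th factor, and [chi] maps it to
    [G x] ([chi_tensor_sum], [tensor_sum_surj]).

    (i) Hence [chi] is surjective exactly when [G] is, that is, as [M] is projective
    over [R], when [G] splits over [R]; dually, [dual_map G] is a left
    [add (D Q)]-approximation which is a split monomorphism over [R]. Conversely the
    [R]-retraction of any such approximation dualizes to an [R]-section of a map
    [Q^k -> M], whose image lies in that of [chi] ([mono_approx_chi_surj]).

    (ii) Let [W : Q^m -> Q^n] be a map with [G W = 0] through which each map
    [Q -> Q^n] killed by [G] factors. The balancing relations only identify
    elements of [Q^n] that differ by an element of the image of [W], so if [chi] is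
    injective then the kernel of [G] is the image of [W] ([ker_sub_image]), and
    [0 -> D M -> D (Q^n) -> D (Q^m)] is the desired sequence
    ([chi_inj_coresolution2]). Conversely, given a sequence
    [0 -> D M -> T_1 -> T_2], each element of the kernel of the induced map
    [G : Q^k -> M] is a sum of values of maps from powers of [Q] to [Q^k]
    killed by [G], and such values represent zero in the tensor product
    ([coresolution2_chi_inj]). *)

(** * Linear maps and finite powers *)

Section LinearMaps.
Variables (S : pzRingType) (M N : lmodType S).

(** The linear map given by a function and a proof of its linearity. *)
Definition lin_of (f : M -> N) (hf : linear f) : {linear M -> N} :=
  HB.pack f (GRing.isLinear.Build S M N *:%R f hf).

End LinearMaps.

Lemma lin_iso_of_bij (S : pzRingType) (M N : lmodType S) (f : {linear M -> N}) :
  injective f -> surj f -> lin_iso f.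
Proof.
move=> finj /choice[g gK].
have gL : linear g by move=> a x y; apply: finj; rewrite gK linearP !gK.
by exists (lin_of gL); split=> x; [apply: finj; exact: gK | exact: gK].
Qed.

Section FinitePowers.
Variables (S : pzRingType) (M N : lmodType S) (n : nat).

(** The [i]-th inclusion of [M] into [M^n]. *)
Fact ffun_inj_linear (i : 'I_n) :
  linear (fun x : M => [ffun j => if j == i then x else 0] : {ffun 'I_n -> M}).
Proof.
move=> a x y; apply/ffunP=> j; rewrite !ffunE.
by case: ifP; rewrite ?scaler0 ?addr0.
Qed.
Definition ffun_inj i : {linear M -> {ffun 'I_n -> M}} := lin_of (ffun_inj_linear i).

(** The [i]-th projection of [M^n] onto [M]. *)
Fact ffun_proj_linear (i : 'I_n) : linear (fun x : {ffun 'I_n -> M} => x i).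
Proof. by move=> a x y; rewrite !ffunE. Qed.
Definition ffun_proj i : {linear {ffun 'I_n -> M} -> M} :=
  lin_of (ffun_proj_linear i).

Lemma sum_ffun_inj (x : {ffun 'I_n -> M}) : x = \sum_i ffun_inj i (x i).
Proof.
apply/ffunP=> j; rewrite sum_ffunE (bigD1 j)//= big1 => [|i ij].
  by rewrite ffunE eqxx addr0.
by rewrite ffunE eq_sym (negbTE ij).
Qed.

(** The map into [M^n] with given components. *)
Fact ffun_pair_linear (f : 'I_n -> {linear N -> M}) :
  linear (fun x => [ffun i => f i x]).
Proof. by move=> a x y; apply/ffunP=> i; rewrite !ffunE linearP. Qed.
Definition ffun_pair f : {linear N -> {ffun 'I_n -> M}} :=
  lin_of (ffun_pair_linear f).

(** The map out of [M^n] with given restrictions to the factors. *)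
Fact ffun_sum_linear (f : 'I_n -> {linear M -> N}) :
  linear (fun x : {ffun 'I_n -> M} => \sum_i f i (x i)).
Proof.
move=> a x y; rewrite scaler_sumr -big_split; apply: eq_bigr => i _.
by rewrite !ffunE linearP.
Qed.
Definition ffun_sum f : {linear {ffun 'I_n -> M} -> N} :=
  lin_of (ffun_sum_linear f).

End FinitePowers.

(** * Dual bases *)

Section DualBases.
Variable S : pzRingType.

(** A finite dual basis: vectors [e i] and functionals [c i] with
    [x = sum_i c i x *: e i] for all [x]. It is equivalent to being finitely
    generated projective, but mentions no other module. The index ranges over any
    finite type so that dual bases of powers are indexed by pairs. *)
Definition dual_basis (P : lmodType S) : Prop :=
  exists (I : finType) (e : I -> P) (c : I -> {linear P -> S^o}),
    forall x, x = \sum_i (c i x : S) *: e i.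

Lemma fg_proj_dual_basis (P : lmodType S) : fg_proj P -> dual_basis P.
Proof.
move=> [[n [e he]] hP].
have lin1 i : linear (fun s : S^o => (s : S) *: e i).
  by move=> a s t; rewrite scalerDl scalerA.
pose p := ffun_sum (fun i : 'I_n => lin_of (lin1 i)).
have psurj : surj p.
  move=> x; have [a ->] := he x; exists [ffun i => a i] => /=.
  by apply: eq_bigr => i _; rewrite ffunE.
have [g gE] := hP _ _ p idfun psurj.
exists 'I_n, e, (fun i => ffun_proj _ i \o g : {linear P -> S^o}) => x.
by rewrite -[LHS](gE x).
Qed.

(** A map out of a module with a dual basis lifts as soon as it does so
    pointwise, so that the submodule through which it factors never has to be
    formed. *)
Lemma dual_basis_lift (P M N : lmodType S) (p : {linear M -> N})
    (f : {linear P -> N}) : dual_basis P ->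
  (forall x, exists y, p y = f x) ->
  exists g : {linear P -> M}, forall x, p (g x) = f x.
Proof.
move=> [I [e [c xE]]] hf.
have [y yE] := choice (fun i => hf (e i)).
have gL : linear (fun x => \sum_i (c i x : S) *: y i).
  move=> a u v; rewrite scaler_sumr -big_split; apply: eq_bigr => i _.
  by rewrite linearP [LHS]scalerDl scalerA.
exists (lin_of gL) => x; rewrite linear_sum [in RHS](xE x) linear_sum.
by apply: eq_bigr => i _; rewrite !linearZ_LR yE.
Qed.

End DualBases.

(** * Submodules over a noetherian ring *)

Section Noetherian.
Variables (R : comPzRingType) (hR : noetherian R) (V : lmodType R).

(** A submodule [U] which is separated by finitely many functionals is finitely
    generated. Induction on the number of functionals: the values of the first one
    on [U] form an ideal, and its kernel in [U] is separated by the others. *)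
Lemma noetherian_submod_fg N (c : 'I_N -> {linear V -> R^o}) (U : V -> Prop) :
  U 0 -> (forall x y, U x -> U y -> U (x + y)) ->
  (forall r x, U x -> U (r *: x)) ->
  (forall x, U x -> (forall i, c i x = 0) -> x = 0) ->
  exists n (v : 'I_n -> V), (forall i, U (v i)) /\
    forall x, U x -> exists a : 'I_n -> R, x = \sum_i a i *: v i.
Proof.
elim: N c U => [|N IH] c U U0 UD UZ csep.
  exists 0%N, (fun=> 0); split=> // x Ux; exists (fun=> 0).
  by rewrite big_ord0; apply: csep => // -[].
have Usum n (v : 'I_n -> V) (a : 'I_n -> R) :
    (forall i, U (v i)) -> U (\sum_i a i *: v i).
  by move=> Uv; elim/big_ind: _ => // i _; exact: UZ.
pose I (r : R) := exists2 x, U x & c ord0 x = r.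
have Iideal : is_ideal I.
  split; first by exists 0; rewrite ?linear0.
    move=> _ _ [x Ux <-] [y Uy <-]; exists (x + y); first exact: UD.
    by rewrite linearD.
  move=> r _ [x Ux <-]; exists (r *: x); first exact: UZ.
  by rewrite linearZ_LR.
have [n [r rE]] := hR Iideal.
have Ir i : exists x, U x /\ c ord0 x = r i.
  have /rE[x Ux xE] : exists a : 'I_n -> R, r i = \sum_j a j * r j.
    exists (fun j => (j == i)%:R).
    by rewrite (bigD1 i)//= eqxx mul1r big1 ?addr0// => j /negbTE->; rewrite mul0r.
  by exists x.
have [x xP] := choice Ir.
have [||||m [v [Uv vE]]] := IH (fun i => c (fintype.lift ord0 i))
    (fun y => U y /\ c ord0 y = 0).
- by rewrite linear0.
- by move=> y z [Uy y0] [Uz z0]; rewrite linearD y0 z0 addr0; split=> //; exact: UD.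
- by move=> s y [Uy y0]; rewrite linearZ_LR y0 scaler0; split=> //; exact: UZ.
- move=> y [Uy y0] cy; apply: csep => // i.
  by have [j ->|->] := unliftP ord0 i; first exact: cy.
exists (n + m)%N, (fun i => match split i with inl j => x j | inr j => v j end).
split=> [i|y Uy].
  by case: (split i) => j; [case: (xP j) | case: (Uv j)].
have /rE[a aE] : I (c ord0 y) by exists y.
(* The x_i adjust the value of the first functional, the v_j the rest. *)
have [|b bE] := vE (y + (-1) *: \sum_i a i *: x i).
  split; first by apply: UD => //; apply/UZ/Usum => i; case: (xP i).
  rewrite linearD linearZ_LR linear_sum scaleN1r aE.
  apply/eqP; rewrite subr_eq0; apply/eqP/eq_bigr => i _.
  by rewrite linearZ_LR (xP i).2.
exists (fun i => match split i with inl j => a j | inr j => b j end).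
rewrite big_split_ord /=.
under eq_bigr do rewrite (unsplitK (inl _)).
under [X in _ + X]eq_bigr do rewrite (unsplitK (inr _)).
by rewrite -bE scaleN1r addrC subrK.
Qed.

End Noetherian.

(** * Homomorphisms from [Q] over a noetherian base *)

Section AlgebraModules.
Variables (R : comPzRingType) (A : pzAlgType R).

Section RestrMap.
Variables (M N : lmodType A) (f : {linear M -> N}).

(** A map of [A]-modules seen as a map of the underlying [R]-modules. *)
Fact restr_map_linear : linear (fun x : restr M => f x : restr N).
Proof. move=> r x y; exact: (linearP f (@alg_map R A r) x y). Qed.
Definition restr_map : {linear restr M -> restr N} := lin_of restr_map_linear.

End RestrMap.

Lemma dual_basis_ffun (Q : lmodType A) n :
  dual_basis (restr Q) -> dual_basis (restr {ffun 'I_n -> Q}).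
Proof.
move=> [I [e [c xE]]].
exists ('I_n * I)%type, (fun ji => restr_map (ffun_inj Q ji.1) (e ji.2)),
  (fun ji => c ji.2 \o restr_map (ffun_proj Q ji.1)
     : {linear restr {ffun 'I_n -> Q} -> R^o}) => x.
rewrite [LHS](@sum_ffun_inj A Q n x).
rewrite -(pair_bigA _ (fun j i => (c i (x j : restr Q) : R) *:
   restr_map (ffun_inj Q j) (e i))) /=.
apply: eq_bigr => j _.
rewrite -[LHS]/(restr_map (ffun_inj Q j) (x j)) [in LHS](xE (x j)).
by rewrite linear_sum; apply: eq_bigr => i _; rewrite linearZ_LR.
Qed.

Lemma sum_homE (M N : lmodType A) (I : finType) (F : I -> homR M N) x :
  ((\sum_i F i : homR M N) : {linear M -> N}) x
  = \sum_i (F i : {linear M -> N}) x.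
Proof.
by apply: (big_morph (fun h : homR M N => (h : {linear M -> N}) x)).
Qed.

(** A map out of [Q] is determined by its values at the generators of [Q], hence
    by the coordinates of these values: finitely many functionals separate the
    points of [Hom_A(Q, N)]. *)
Lemma noetherian_hom_fg (hR : noetherian R) (Q N : lmodType A)
    (U : homR Q N -> Prop) :
  fin_gen Q -> dual_basis (restr N) ->
  U 0 -> (forall x y, U x -> U y -> U (x + y)) ->
  (forall r x, U x -> U (r *: x)) ->
  exists n (v : 'I_n -> homR Q N), (forall i, U (v i)) /\
    forall x, U x -> exists a : 'I_n -> R, x = \sum_i a i *: v i.
Proof.
move=> [k [q qE]] [I [e [c xE]]] U0 UD UZ.
have cL (ji : 'I_k * I) :
    linear (fun h : homR Q N => c ji.2 ((h : {linear Q -> N}) (q ji.1))).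
  by move=> r h h'; rewrite -linearP.
apply: (noetherian_submod_fg hR
  (c := fun s : 'I_#|{: 'I_k * I}| => lin_of (cL (enum_val s)))) => // h _ ch.
apply: linear_ext => x; have [a ->] := qE x; rewrite !linear_sum.
apply: eq_bigr => j _; rewrite !linearZ_LR; congr (_ *: _).
rewrite [LHS](xE (_ : restr N)) big1// => i _.
by have := ch (enum_rank (j, i)); rewrite /= enum_rankK /= => ->; rewrite scale0r.
Qed.

(** The maps from [Q] to the kernel of [G] are all combinations of finitely many
    of them; putting these together gives [W]. *)
Lemma ker_right_approx (hR : noetherian R) (Q N M : lmodType A)
    (G : {linear N -> M}) : fin_gen Q -> dual_basis (restr N) ->
  exists n (W : {linear {ffun 'I_n -> Q} -> N}),
    (forall x, G (W x) = 0) /\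
    forall b : {linear Q -> N}, (forall x, G (b x) = 0) ->
      exists h : {linear Q -> {ffun 'I_n -> Q}}, forall x, W (h x) = b x.
Proof.
move=> hQ hN.
have [|||n [w [Gw wE]]] := @noetherian_hom_fg hR Q N
  (fun b => forall x, G ((b : {linear Q -> N}) x) = 0) hQ hN.
- by move=> x; rewrite [LHS]linear0.
- by move=> b b' Gb Gb' x; rewrite [LHS]linearD Gb Gb' addr0.
- by move=> r b Gb x; rewrite [LHS]linearZ_LR Gb scaler0.
exists n, (ffun_sum (fun i => w i : {linear Q -> N})); split=> [x|b Gb] /=.
  by rewrite linear_sum big1.
have [a ->] := wE _ Gb.
exists (ffun_pair (fun i => hom_scale (a i) (idfun : {linear Q -> Q}))) => x.
rewrite sum_homE /=; apply: eq_bigr => i _.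
by rewrite ffunE [LHS]linearZ_LR.
Qed.

End AlgebraModules.

(** * Duality over the base ring *)

Section Duality.
Variables (R : comPzRingType) (A : pzAlgType R).
Local Notation D M := (dual M : lmodType A^c).

Lemma dualDE (M : lmodType A) (f g : dual M) x :
  (f + g : dual M) x = f x + g x.
Proof. by []. Qed.

Lemma dualZE (M : lmodType A) (a : A) (f : dual M) x :
  ((a : A^c) *: (f : D M) : dual M) x = f (a *: (x : M)).
Proof. by []. Qed.

Lemma dual_restrZE (M : lmodType A) (r : R) (f : restr (D M)) x :
  ((r *: f : restr (D M)) : dual M) x = r * (f : dual M) x.
Proof. exact: (linearZ_LR (f : {linear restr M -> R^o}) r x). Qed.

Lemma dual_sumE (M : lmodType A) (I : finType) (F : I -> dual M) x :
  ((\sum_i F i : dual M) : {linear restr M -> R^o}) x = \sum_i F i x.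
Proof.
by apply: (big_morph (fun h : dual M => h x)).
Qed.

(** The transpose of [h], a map of right [A]-modules. *)
Section DualMap.
Variables (M N : lmodType A) (h : {linear M -> N}).
Fact dual_map_linear :
  linear (fun f : D N => ((f : {linear restr N -> R^o}) \o restr_map h
                         : {linear restr M -> R^o}) : D M).
Proof.
move=> a f g; apply: linear_ext => x.
rewrite [LHS]dualDE [RHS]dualDE; congr (_ + _).
rewrite [RHS]dualZE [LHS]dualZE; congr ((f : dual N) _).
by rewrite /= linearZ_LR.
Qed.
Definition dual_map : {linear D N -> D M} := lin_of dual_map_linear.

Lemma dual_mapE (f : dual N) x : (dual_map f : dual M) x = f (h x).
Proof. by []. Qed.
End DualMap.

Lemma dual_map_comp (L M N : lmodType A) (h : {linear M -> N})
    (k : {linear L -> M}) (f : dual N) :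
  dual_map (h \o k : {linear L -> N}) f = dual_map k (dual_map h f).
Proof. exact: linear_ext. Qed.

(** The functionals on [M] separate its points. *)
Lemma dual_sep (M : lmodType A) (x y : M) : dual_basis (restr M) ->
  (forall f : dual M, f x = f y) -> x = y.
Proof.
move=> [I [e [c xE]]] xy; rewrite [LHS](xE (x : restr M)) [RHS](xE (y : restr M)).
by apply: eq_bigr => i _; rewrite (xy (c i)).
Qed.

(** [M] is reflexive over [R]. *)
Lemma dual_eval (M : lmodType A) (l : {linear restr (D M) -> R^o}) :
  dual_basis (restr M) -> exists x : M, forall f : dual M, l f = f x.
Proof.
move=> [I [e [c xE]]]; exists (\sum_i (l (c i) : R) *: e i) => f.
have fE : f = \sum_i (f (e i) : R) *: (c i : restr (D M)).
  apply: linear_ext => x; rewrite [in LHS](xE x) linear_sum dual_sumE.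
  apply: eq_bigr => i _; rewrite linearZ_LR [RHS]dual_restrZE.
  by rewrite [LHS]mulrC.
rewrite [in LHS]fE !linear_sum; apply: eq_bigr => i _.
rewrite !linearZ_LR; exact: mulrC.
Qed.

(** The functor [D] is full. The value [h x] represents the functional
    [f |-> u f x] on [D N], and is determined by it. *)
Lemma dual_full (M N : lmodType A) (u : {linear D N -> D M}) :
  dual_basis (restr N) ->
  exists h : {linear M -> N}, forall f, u f = dual_map h f.
Proof.
move=> hN.
have hx (x : M) : exists y : N, forall f : dual N, (u f : dual M) x = f y.
  have lL : linear (fun f : restr (D N) => (u f : dual M) x : R^o).
    move=> r f g; rewrite [u _](linearP (restr_map u) r f g).
    by rewrite [LHS]dualDE [X in X + _]dual_restrZE.
  by have [y yE] := dual_eval (lin_of lL) hN; exists y.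
have [h hE] := choice hx.
have hL : linear h.
  move=> a x y; apply: dual_sep => // f.
  rewrite -hE [LHS](linearD (u f : {linear restr M -> R^o})).
  rewrite [RHS](linearD (f : {linear restr N -> R^o})) -!hE; congr (_ + _).
  rewrite -[LHS]dualZE -[RHS]dualZE -hE.
  by rewrite -(linearZ_LR u).
by exists (lin_of hL) => f; apply: linear_ext => x; rewrite hE.
Qed.

Lemma dual_map_inj0 (M N : lmodType A) (h : {linear M -> N}) :
  dual_basis (restr N) -> (forall f, dual_map h f = 0) -> forall x, h x = 0.
Proof.
move=> hN h0 x; apply: dual_sep => // f.
by rewrite -(dual_mapE h f x) h0 [RHS]linear0.
Qed.

Section DualPower.
Variables (Q : lmodType A) (n : nat).

(** [dual_ffun] and [ffun_dual] are inverse isomorphisms between [D (Q^n)] and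
    [(D Q)^n]. *)
Definition dual_ffun : {linear D {ffun 'I_n -> Q} -> {ffun 'I_n -> D Q}} :=
  ffun_pair (fun i => dual_map (ffun_inj Q i)).

Definition ffun_dual : {linear {ffun 'I_n -> D Q} -> D {ffun 'I_n -> Q}} :=
  ffun_sum (fun i => dual_map (ffun_proj Q i)).

Lemma ffun_dualE (f : {ffun 'I_n -> D Q}) (x : {ffun 'I_n -> Q}) :
  (ffun_dual f : dual _) x = \sum_i (f i : dual Q) (x i).
Proof. exact: dual_sumE. Qed.

Lemma dual_ffunK : cancel dual_ffun ffun_dual.
Proof.
move=> f; apply: linear_ext => x; rewrite ffun_dualE.
rewrite [in RHS](sum_ffun_inj (x : {ffun 'I_n -> Q})) [RHS]linear_sum.
by apply: eq_bigr => i _; rewrite ffunE.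
Qed.

Lemma ffun_dualK : cancel ffun_dual dual_ffun.
Proof.
move=> f; apply/ffunP => i; rewrite ffunE; apply: linear_ext => x.
rewrite dual_mapE ffun_dualE (bigD1 i)//= big1 => [|j ji].
  by rewrite ffunE eqxx addr0.
by rewrite ffunE (negbTE ji) [LHS]linear0.
Qed.

End DualPower.

Lemma in_addP (Q : lmodType A) (X : lmodType A^c) :
  in_add (D Q) X <-> exists k (i : {linear X -> D {ffun 'I_k -> Q}})
    (p : {linear D {ffun 'I_k -> Q} -> X}), cancel i p.
Proof.
split=> -[k [i [p ipK]]].
  exists k, (@ffun_dual Q k \o i : {linear X -> D {ffun 'I_k -> Q}}),
    (p \o @dual_ffun Q k : {linear D {ffun 'I_k -> Q} -> X}) => x.
  by rewrite -[RHS]ipK; congr (p _); exact: ffun_dualK.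
exists k, (@dual_ffun Q k \o i : {linear X -> {ffun 'I_k -> D Q}}),
  (p \o @ffun_dual Q k : {linear {ffun 'I_k -> D Q} -> X}) => x.
by rewrite -[RHS]ipK; congr (p _); exact: dual_ffunK.
Qed.

End Duality.

(** * The evaluation map *)

Lemma tensor_null_pi (B : pzRingType) (P : lmodType B^c) (N : lmodType B)
    (u : {freeg (P * N)%type / int}) :
  \pi_(Quotient.quot (@tensor_rel B P N)) u = 0%R -> tensor_null u.
Proof.
move=> u0; apply/asboolP; rewrite -[asbool _]/(u \in @tensor_rel B P N).
by rewrite -[u]subr0 (@Quotient.idealrBE _ (@tensor_rel B P N)) u0 raddf0.
Qed.

Section Evaluation.
Variables (S : pzRingType) (Q M : lmodType S) (n : nat).
Variable G : {linear {ffun 'I_n -> Q} -> M}.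

Local Notation comp_inj j := ((G \o ffun_inj Q j : {linear Q -> M}) : hom_end Q M).
Local Notation QB := (end_right Q).
Local Notation HQM := (hom_end Q M).

(** The element [sum_j x_j (x) G_j], with [G_j] the restriction of [G] to the
    [j]-th factor of [Q^n]. *)
Definition tensor_sum (x : {ffun 'I_n -> Q}) : tensor_hom Q M :=
  \sum_j pure (x j : QB) (comp_inj j).

Lemma pure0l (g : HQM) : pure (0 : QB) g = 0.
Proof. by apply: (addrI (pure 0 g)); rewrite -pureDl !addr0. Qed.

Lemma pure0r (q : QB) : pure q (0 : HQM) = 0.
Proof. by apply: (addrI (pure q 0)); rewrite -pureDr !addr0. Qed.

Lemma pureNl (q : QB) (g : HQM) : pure (- q) g = - pure q g.
Proof. by apply: (addrI (pure q g)); rewrite -pureDl !subrr pure0l. Qed.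

Lemma pure_sumr (q : QB) (I : finType) (F : I -> HQM) :
  pure q (\sum_i F i) = \sum_i pure q (F i).
Proof.
by apply: (big_morph (pure q)); [exact: pureDr | exact: pure0r].
Qed.

Lemma sum_hom_endE (I : finType) (F : I -> HQM) x :
  ((\sum_i F i : HQM) : {linear Q -> M}) x = \sum_i (F i : {linear Q -> M}) x.
Proof. by apply: (big_morph (fun h : HQM => (h : {linear Q -> M}) x)). Qed.

Lemma tensor_sum_zmod_morphism : zmod_morphism tensor_sum.
Proof.
move=> x y; rewrite /tensor_sum -sumrB; apply: eq_bigr => j _.
by rewrite !ffunE [LHS]pureDl pureNl.
Qed.

HB.instance Definition _ :=
  GRing.isZmodMorphism.Build {ffun 'I_n -> Q} (tensor_hom Q M) tensor_sum
    tensor_sum_zmod_morphism.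

Lemma chi_tensor_sum x : chi Q M (tensor_sum x) = G x.
Proof.
rewrite [in RHS](sum_ffun_inj x) !linear_sum; apply: eq_bigr => j _.
exact: chi_pure.
Qed.

Lemma tensor_sum_comp (h : {linear Q -> {ffun 'I_n -> Q}}) (q : Q) :
  tensor_sum (h q) = pure (q : QB) ((G \o h : {linear Q -> M}) : HQM).
Proof.
rewrite /tensor_sum.
(* Since G h is the sum over j of G_j h_j, the endomorphisms h_j may be moved
   across the tensor sign. *)
have -> : ((G \o h : {linear Q -> M}) : HQM) = \sum_j
    ((ffun_proj Q j \o h : {linear Q -> Q}) : end_op Q) *: comp_inj j.
  apply: linear_ext => x; rewrite sum_hom_endE /=.
  by rewrite [in LHS](sum_ffun_inj (h x)) linear_sum.
by rewrite pure_sumr; apply: eq_bigr => j _; rewrite -pureZ.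
Qed.

Lemma tensor_sum_ker m (b : {linear {ffun 'I_m -> Q} -> {ffun 'I_n -> Q}}) :
  (forall z, G (b z) = 0) -> forall z, tensor_sum (b z) = 0.
Proof.
move=> Gb z; rewrite [in LHS](sum_ffun_inj z) !raddf_sum big1// => j _.
rewrite [LHS](tensor_sum_comp (b \o ffun_inj Q j : {linear Q -> {ffun 'I_n -> Q}})).
have -> : ((G \o (b \o ffun_inj Q j) : {linear Q -> M}) : HQM) = 0.
  by apply: linear_ext => x /=; rewrite Gb.
exact: pure0r.
Qed.

Hypothesis G_approx : forall g : {linear Q -> M},
  exists h : {linear Q -> {ffun 'I_n -> Q}}, forall x, G (h x) = g x.

Lemma tensor_sum_surj : surj tensor_sum.
Proof.
elim/tensor_ind => [|t u [x <-] [y <-]|q g].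
- by exists 0; rewrite raddf0.
- by exists (x - y); rewrite raddfB.
- have [h Gh] := G_approx (g : {linear Q -> M}); exists (h q).
  rewrite tensor_sum_comp; congr (pure _ _); exact: linear_ext.
Qed.

(** The relations that define the tensor product are sent into the image of [W]
    by the additive map [q (x) g |-> h_g q], where [h_g] is a lift of [g] through
    [G]. *)
Lemma ker_sub_image m (W : {linear {ffun 'I_m -> Q} -> {ffun 'I_n -> Q}}) :
  (forall b : {linear Q -> {ffun 'I_n -> Q}}, (forall x, G (b x) = 0) ->
     exists h : {linear Q -> {ffun 'I_m -> Q}}, forall x, W (h x) = b x) ->
  injective (chi Q M) -> forall x, G x = 0 -> exists y, W y = x.
Proof.
move=> W_approx chi_inj x Gx.
have W_im (b : {linear Q -> {ffun 'I_n -> Q}}) q :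
    (forall x, G (b x) = 0) -> exists y, W y = b q.
  by move=> /W_approx[h hE]; exists (h q).
have [h hE] := choice G_approx.
pose phi (q : QB) (g : HQM) : {ffun 'I_n -> Q} := h (g : {linear Q -> M}) q.
have phi_null u : tensor_null u -> exists y, W y = flift phi u.
  elim=> [|y z _ [y' y'E] _ [z' z'E]|p p' g|p g g'|p b g].
  - by exists 0; rewrite linear0 raddf0.
  - by exists (y' - z'); rewrite linearB y'E z'E raddfB.
  - exists 0; rewrite linear0 raddfB raddfD /= !flift_gen /phi.
    by rewrite [h _ (_ + _)]linearD subrr.
  - rewrite raddfB raddfD /= !flift_gen /phi.
    apply: (W_im (h (g + g') - (h g + h g'))) => z.
    rewrite [LHS]linearB linearD !hE; exact: subrr.
  - rewrite raddfB /= !flift_gen /phi.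
    apply: (W_im ((h g \o (b : {linear Q -> Q})
                  : {linear Q -> {ffun 'I_n -> Q}}) - h (b *: g))) => z.
    rewrite [LHS]linearB !hE; exact: subrr.
pose gen p g := (Freeg [:: (1%:Z, (p, g))] : {freeg (QB * HQM)%type / int}).
(* The sum over j of x_j (x) G_j is a relation, and its image under flift phi
   differs from x by an element of the image of W, as h_(G_j) and the j-th
   inclusion both lift G_j. *)
have [|y yE] := phi_null (\sum_j gen (x j) (comp_inj j)).
  apply: tensor_null_pi; rewrite raddf_sum -[LHS]/(tensor_sum x).
  by apply: chi_inj; rewrite chi_tensor_sum Gx linear0.
have [y' y'E] : exists y', W y' =
    \sum_j (ffun_inj Q j (x j) - phi (x j) (comp_inj j)).
  have yj j : exists y', W y' = ffun_inj Q j (x j) - phi (x j) (comp_inj j).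
    apply: (W_im (ffun_inj Q j - h (comp_inj j))) => z.
    rewrite [LHS]linearB hE; exact: subrr.
  have [y'_ y'E] := choice yj; exists (\sum_j y'_ j).
  by rewrite linear_sum; apply: eq_bigr => j _; exact: y'E.
exists (y + y'); rewrite linearD yE y'E sumrB -sum_ffun_inj raddf_sum /=.
under eq_bigr do rewrite flift_gen.
by rewrite addrC subrK.
Qed.

End Evaluation.

(** * Lower bounds on the dominant dimension *)

Section DominantDimensionBounds.

(** The supremum is the maximum if the set is bounded, and infinity otherwise. *)
Lemma nat_supremum_exists (P : nat -> Prop) : P 0%N ->
  (supremums [set n%:Z%:E | n in P] !=set0)%classic.
Proof.
move=> P0; have [[m mP]|P_unb] := pselect (exists m, forall n, P n -> (n <= m)%N).
  have exP : exists n, `[< P n >] by exists 0%N; apply/asboolP.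
  have leP n : `[< P n >] -> (n <= m)%N by move=> /asboolP/mP.
  have [k /asboolP Pk kmax] := ex_maxnP exP leP.
  exists k%:Z%:E; split=> [_ [n Pn <-]|y]; last by apply; exists k.
  by rewrite lee_fin lez_nat; apply: kmax; apply/asboolP.
exists +oo%E; split=> [_ [n _ <-]|y yub]; first exact: leey.
case: y yub => [r|//|] yub; last by have := yub _ (ex_intro2 _ _ 0%N P0 erefl).
case: P_unb; exists `|r|%N => n Pn; have := yub _ (ex_intro2 _ _ n Pn erefl).
by rewrite lee_fin -lez_nat => /le_trans; apply; rewrite abszE ler_norm.
Qed.

Lemma le_nat_supremum (P : nat -> Prop) m : P 0%N -> (0 < m)%N ->
  (m%:Z%:E <= supremum 0 [set n%:Z%:E | n in P]%classic)%E <->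
  exists2 n, (m <= n)%N & P n.
Proof.
move=> P0 m0; have supP := nat_supremum_exists P0; split=> [mle|[n mn Pn]].
  apply: contrapT => hn; have Pm n : P n -> (n <= m.-1)%N.
    by move=> Pn; rewrite leqNgt prednK//; apply/negP => mn; apply: hn; exists n.
  have : (supremum 0 [set n%:Z%:E | n in P]%classic <= m.-1%:Z%:E)%E.
    rewrite /supremum; case: ifP => [/eqP E0|_].
      by have := E0; move/seteqP => [+ _] => /(_ 0%E) []; exists 0%N.
    case: xgetP => [y _ [_ ylub]|]; last by case: supP => y /[swap]/(_ y).
    by apply: ylub => _ [n Pn <-]; rewrite lee_fin lez_nat; exact: Pm.
  by move/(le_trans mle); rewrite lee_fin lez_nat leqNgt ltn_predL m0.
apply: (@le_trans _ _ n%:Z%:E); first by rewrite lee_fin lez_nat.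
by apply: ge_supremum_Nmem => //; exists n.
Qed.

Variables (R : comPzRingType) (A : pzAlgType R) (T X : lmodType A).

Lemma has_add_coresolution_leq m n : (m <= n)%N ->
  has_add_coresolution T X n -> has_add_coresolution T X m.
Proof.
move=> mn [T_ [d [T_add [[d0 d1] dsplit] [h0 h1]]]].
exists T_, d; split=> [i im||].
- by apply: T_add; exact: leq_trans mn.
- split; [split=> [m0|i im]|move=> i im].
  + by apply: d0; exact: leq_trans mn.
  + by apply: d1; exact: leq_trans mn.
  + by apply: dsplit; exact: leq_trans mn.
- split=> [m0|i im]; [apply: h0|apply: h1]; exact: leq_trans mn.
Qed.

(** The sequence [0 -> X -> T0 -> T1], continued by [T1] and zero maps: only its
    first maps matter in a coresolution of length at most two. *)
Definition two_terms (T0 T1 : lmodType A) (i : nat) : lmodType A :=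
  if i is 0%N then T0 else T1.

Definition two_maps (T0 T1 : lmodType A) (d0 : {linear X -> T0})
    (d1 : {linear T0 -> T1}) (i : nat) :
    {linear coaug X (two_terms T0 T1) i -> coaug X (two_terms T0 T1) i.+1} :=
  match i with 0%N => d0 | 1%N => d1 | i.+2 => \0 end.

(** The condition that makes the dominant dimension the supremum of the lengths of
    the coresolutions rather than zero by convention. *)
Definition has_mono_approx : Prop :=
  exists (N : lmodType A) (f : {linear X -> N}), left_add_approx T f /\ rel_mono f.

Lemma has_add_coresolution0 : has_add_coresolution T X 0.
Proof.
exists (fun=> X),
  (fun i => \0 : {linear coaug X (fun=> X) i -> coaug X (fun=> X) i.+1}).
by split=> //; split=> //; split.
Qed.

Lemma le_domdim m : (0 < m)%N -> (m%:Z%:E <= domdim T X)%E <->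
  has_mono_approx /\ has_add_coresolution T X m.
Proof.
move=> m0; rewrite /domdim; case: ifPn => [/asboolP ha|/asboolPn nha]; last first.
  by split=> [|[]//]; rewrite lee_fin lez_nat leqNgt m0.
rewrite le_nat_supremum //; last exact: has_add_coresolution0.
split=> [[n mn /(has_add_coresolution_leq mn)]//|[_ hm]]; by exists m.
Qed.

Lemma mono_approx_coresolution1 : has_mono_approx -> has_add_coresolution T X 1.
Proof.
move=> [N [f [[Nadd fext] [s sK]]]].
have TT : in_add T T.
  exists 1%N, (ffun_inj T ord0), (ffun_proj T ord0) => x.
  by rewrite /= !ffunE eqxx.
exists (two_terms N N), (two_maps f (\0 : {linear N -> N})).
split=> [[|//] _ //||].
- split; [split=> // _ x y /(congr1 s)|case=> // _]; first by rewrite !sK.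
  by exists s => x; exact: (congr1 f (sK x)).
- by split=> // _ g; exact: (fext _ TT).
Qed.

Lemma le1_domdim : (1%:Z%:E <= domdim T X)%E <-> has_mono_approx.
Proof.
rewrite le_domdim//; split=> [[]//|h]; split=> //.
exact: mono_approx_coresolution1.
Qed.

End DominantDimensionBounds.

(** * Coresolutions of the dual and the evaluation map *)

Section RelativeDuality.
Variables (R : comPzRingType) (A : pzAlgType R).
Local Notation D M := (dual M : lmodType A^c).

(** The transpose of an [R]-linear map [s], which need not respect the action of
    [A]. *)
Section DualRestrMap.
Variables (M N : lmodType A) (s : {linear restr M -> restr N}).
Fact dual_restr_map_linear :
  linear (fun f : restr (D N) =>
    ((f : {linear restr N -> R^o}) \o s : {linear restr M -> R^o}) : restr (D M)).
Proof.
move=> r f g; apply: linear_ext => x.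
rewrite [LHS]dualDE [RHS]dualDE; congr (_ + _).
by rewrite [RHS]dual_restrZE [LHS]dual_restrZE.
Qed.
Definition dual_restr_map : {linear restr (D N) -> restr (D M)} :=
  lin_of dual_restr_map_linear.
End DualRestrMap.

Variables (Q M : lmodType A).
Hypothesis bQ : dual_basis (restr Q).
Hypothesis bM : dual_basis (restr M).

Lemma in_add_dual_power n : in_add (D Q) (D {ffun 'I_n -> Q}).
Proof. by apply/in_addP; exists n, idfun, idfun. Qed.

Section Approximation.
Variables (n : nat) (G : {linear {ffun 'I_n -> Q} -> M}).
Hypothesis G_approx : forall g : {linear Q -> M},
  exists h : {linear Q -> {ffun 'I_n -> Q}}, forall x, G (h x) = g x.

Lemma dual_map_extend (u : {linear D M -> D Q}) :
  exists h : {linear D {ffun 'I_n -> Q} -> D Q}, forall f, h (dual_map G f) = u f.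
Proof.
have [g ug] := dual_full u bM; have [h Gh] := G_approx g.
exists (dual_map h) => f; rewrite ug; apply: linear_ext => x.
by rewrite !dual_mapE Gh.
Qed.

Lemma dual_map_left_approx : left_add_approx (D Q) (dual_map G).
Proof.
split=> [|Y [k [i [p ipK]]] g]; first exact: in_add_dual_power.
have [h hE] := choice (fun j => dual_map_extend
  (ffun_proj (D Q) j \o (i \o g) : {linear D M -> D Q})).
exists (p \o ffun_pair h : {linear D {ffun 'I_n -> Q} -> Y}) => f.
rewrite -[RHS]ipK; congr (p _); apply/ffunP => j; rewrite ffunE.
exact: hE.
Qed.

End Approximation.

Lemma dual_map_retract (N : lmodType A) (G : {linear N -> M})
    (s : {linear restr M -> restr N}) :
  (forall x, G (s x) = x) -> forall f, dual_restr_map s (dual_map G f) = f.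
Proof. by move=> Gs f; apply: linear_ext => x; rewrite [LHS]dual_mapE Gs. Qed.

(** An [R]-linear retraction of [dual_map G] is, by reflexivity of [N], the
    transpose of a section of [G]. *)
Lemma dual_split_mono_surj (N : lmodType A) (G : {linear N -> M})
    (s : {linear restr (D N) -> restr (D M)}) : dual_basis (restr N) ->
  (forall f, s (dual_map G f) = f) -> surj G.
Proof.
move=> bN sK x.
have lL : linear (fun f : restr (D N) => (s f : dual M) x : R^o).
  move=> r f g; rewrite [s _]linearP.
  by rewrite [LHS]dualDE [X in X + _]dual_restrZE.
have [y yE] := dual_eval (lin_of lL) bN; exists y; apply: dual_sep => // f.
by rewrite -[LHS](dual_mapE G) -yE /= sK.
Qed.

Lemma surj_section (N : lmodType A) (G : {linear N -> M}) : surj G ->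
  exists s : {linear restr M -> restr N}, forall x, G (s x) = x.
Proof.
move=> Gsurj; apply: (dual_basis_lift (p := restr_map G)
  (f := (idfun : {linear restr M -> restr M})) bM); exact: Gsurj.
Qed.

Lemma chi_surj_section n (G : {linear {ffun 'I_n -> Q} -> M}) :
  (forall g : {linear Q -> M},
    exists h : {linear Q -> {ffun 'I_n -> Q}}, forall x, G (h x) = g x) ->
  surj (chi Q M) ->
  exists s : {linear restr M -> restr {ffun 'I_n -> Q}}, forall x, G (s x) = x.
Proof.
move=> G_approx chi_surj; apply: surj_section => x.
have [t <-] := chi_surj x; have [y <-] := tensor_sum_surj G_approx t.
by exists y; rewrite chi_tensor_sum.
Qed.

(** Only the retraction is used, not the approximation property. *)
Lemma mono_approx_chi_surj : has_mono_approx (D Q) (D M) -> surj (chi Q M).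
Proof.
move=> [N [f [[/in_addP[k [i [p ipK]]] _] [s sK]]]] x.
have [G GE] := dual_full (i \o f : {linear D M -> D {ffun 'I_k -> Q}}) bM.
have [|y <-] := dual_split_mono_surj (G := G)
    (s := s \o restr_map p : {linear restr (D {ffun 'I_k -> Q}) -> restr (D M)})
    (dual_basis_ffun k bQ) _ x.
  by move=> g; rewrite -GE /= ipK sK.
by exists (tensor_sum G y); rewrite chi_tensor_sum.
Qed.

Lemma chi_inj_coresolution2 n m (G : {linear {ffun 'I_n -> Q} -> M})
    (W : {linear {ffun 'I_m -> Q} -> {ffun 'I_n -> Q}}) :
  (forall g : {linear Q -> M},
    exists h : {linear Q -> {ffun 'I_n -> Q}}, forall x, G (h x) = g x) ->
  (forall x, G (W x) = 0) ->
  (forall b : {linear Q -> {ffun 'I_n -> Q}}, (forall x, G (b x) = 0) ->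
     exists h : {linear Q -> {ffun 'I_m -> Q}}, forall x, W (h x) = b x) ->
  surj (chi Q M) -> injective (chi Q M) ->
  has_add_coresolution (D Q) (D M) 2.
Proof.
move=> G_approx GW W_approx chi_surj chi_inj.
have [s Gs] := chi_surj_section G_approx chi_surj.
have G_sub x : G (x - s (G x)) = 0 by rewrite linearB /= Gs subrr.
(* The projection 1 - s G onto the kernel of G lifts through W, which yields the
   splitting of the second map. *)
have [t Wt] : exists t : {linear restr {ffun 'I_n -> Q} -> restr {ffun 'I_m -> Q}},
    forall x, W (t x) = x - s (G x).
  apply: (dual_basis_lift (p := restr_map W)
    (f := (idfun : {linear restr {ffun 'I_n -> Q} -> restr {ffun 'I_n -> Q}}) -
      (s \o restr_map G
        : {linear restr {ffun 'I_n -> Q} -> restr {ffun 'I_n -> Q}}))).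
    exact: dual_basis_ffun.
  by move=> x; exact: (ker_sub_image G_approx W_approx chi_inj (G_sub x)).
have d1d0 f : dual_map W (dual_map G f) = 0.
  by apply: linear_ext => x; rewrite dual_mapE [LHS]dual_mapE GW linear0.
(* A functional that vanishes on the image of W vanishes on the kernel of G,
   hence factors through G. *)
have killed (f : dual {ffun 'I_n -> Q}) :
    dual_map W f = 0 -> dual_map G (dual_restr_map s f) = f.
  move=> Wf; apply: linear_ext => x; rewrite dual_mapE.
  apply/esym/eqP; rewrite -subr_eq0 -[X in X == _]linearB -Wt.
  by rewrite -(dual_mapE W f) Wf.
exists (two_terms (D {ffun 'I_n -> Q}) (D {ffun 'I_m -> Q})),
  (two_maps (dual_map G) (dual_map W)).
split.
- by case=> [|[|//]] _; exact: in_add_dual_power.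
- split.
    split=> [_ f g /(congr1 (dual_restr_map s))|[|//] _ f].
      by rewrite !(dual_map_retract Gs).
    split=> [Wf|[g <-]]; last exact: d1d0.
    by exists (dual_restr_map s f); exact: killed.
  case=> [|[|//]] _.
    exists (dual_restr_map s) => f; exact: (congr1 _ (dual_map_retract Gs f)).
  exists (dual_restr_map t) => f; apply: linear_ext => x.
  rewrite [LHS]dual_mapE [LHS]dual_mapE Wt GW linear0 subr0.
  by rewrite -[RHS]dual_mapE.
- split=> [_ g|[|//] _ u]; first exact: dual_map_extend.
  split=> [ud0|[h hE] f]; last first.
    by rewrite -hE -[RHS](linear0 h); exact: (congr1 h (d1d0 f)).
  have [b bE] := dual_full u (dual_basis_ffun n bQ).
  have [x|h Wh] := W_approx b.
    apply: (dual_map_inj0 (h := G \o b : {linear Q -> M})) => // f.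
    by rewrite dual_map_comp -bE; exact: ud0.
  exists (dual_map h) => f; rewrite bE; apply: linear_ext => x.
  by rewrite !dual_mapE Wh.
Qed.

Lemma coresolution2_chi_inj :
  has_add_coresolution (D Q) (D M) 2 -> injective (chi Q M).
Proof.
move=> [T_ [d [T_add [[_ exact1] dsplit] [ext _]]]].
pose d0 : {linear D M -> T_ 0%N} := d 0%N.
pose d1 : {linear T_ 0%N -> T_ 1%N} := d 1%N.
have [/in_addP[k [i0 [p0 ipK0]]] /in_addP[l [i1 [p1 ipK1]]]] :=
  (T_add 0%N isT, T_add 1%N isT).
have [s sE] : exists s : {linear restr (T_ 1%N) -> restr (T_ 0%N)},
    forall x, d1 (s (d1 x)) = d1 x := dsplit 1%N isT.
have d1d0 f : d1 (d0 f) = 0 by apply/(exact1 0%N isT); exists f.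
have bQk := dual_basis_ffun k bQ; have bQl := dual_basis_ffun l bQ.
(* G, V and C are the transposes of D M -> D (Q^k), of D (Q^k) -> D (Q^l), and of
   the projection onto the complement of T_ 0 in D (Q^k). *)
have [G GE] := dual_full (i0 \o d0 : {linear D M -> D {ffun 'I_k -> Q}}) bM.
have [V VE] := dual_full (i1 \o (d1 \o p0)
  : {linear D {ffun 'I_k -> Q} -> D {ffun 'I_l -> Q}}) bQk.
have [C CE] := dual_full ((idfun : {linear D {ffun 'I_k -> Q} -> _}) -
  (i0 \o p0 : {linear D {ffun 'I_k -> Q} -> D {ffun 'I_k -> Q}})) bQk.
have G_approx (g : {linear Q -> M}) :
    exists h : {linear Q -> {ffun 'I_k -> Q}}, forall x, G (h x) = g x.
  have [u uE] : exists u : {linear T_ 0%N -> D Q}, forall f, u (d0 f) = dual_map g f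
    := ext isT (dual_map g).
  have [h hE] := dual_full (u \o p0 : {linear D {ffun 'I_k -> Q} -> D Q}) bQk.
  exists h => x; apply: dual_sep => // f.
  rewrite -[RHS]dual_mapE -uE -[in RHS](ipK0 (d0 f)) [X in X = _](_ : _ =
    (dual_map h (dual_map G f) : dual Q) x) //.
  by rewrite -hE -GE.
have GV z : G (V z) = 0.
  apply: (dual_map_inj0 (h := G \o V : {linear {ffun 'I_l -> Q} -> M})) => // f.
  by rewrite dual_map_comp -VE -GE /= ipK0 d1d0 linear0.
have GC z : G (C z) = 0.
  apply: (dual_map_inj0 (h := G \o C : {linear {ffun 'I_k -> Q} -> M})) => // f.
  by rewrite dual_map_comp -CE -GE /= ipK0 subrr.
(* A functional f on Q^k is the sum of its component in the complement of T_ 0, of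
   a term that is a linear function of d1 (p0 f) through the splitting s, and of
   an element of the image of d0. Evaluation at x in the kernel of G kills the
   third, so f x = f (C x) + f (V y), where y represents the second. *)
have kerG x : G x = 0 -> exists y, x = C x + V y.
  move=> Gx.
  have lL : linear (fun g : restr (D {ffun 'I_l -> Q}) =>
      (i0 (s (p1 g)) : dual {ffun 'I_k -> Q}) x : R^o).
    move=> r g h.
    rewrite [i0 _](linearP (restr_map i0 \o (s \o restr_map p1))).
    by rewrite [LHS]dualDE [X in X + _]dual_restrZE.
  have [y yE] := dual_eval (lin_of lL) bQl; exists y.
  apply: dual_sep => // f; rewrite [RHS]linearD.
  rewrite -[X in _ = X + _]dual_mapE -[X in _ = _ + X]dual_mapE -CE -VE.
  rewrite -[X in _ = _ + X]yE /= ipK1.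
  have [g gE] : exists g, d0 g = p0 f - s (d1 (p0 f)).
    by apply/(exact1 0%N isT); rewrite [LHS]linearB -/d1 sE subrr.
  have := congr1 (fun g : dual _ => g x) (GE g).
  rewrite dual_mapE Gx linear0 /= gE linearB => /eqP; rewrite subr_eq0 => /eqP h.
  by rewrite -h subrK.
have inj0 t : chi Q M t = 0 -> t = 0.
  have [x <-] := tensor_sum_surj G_approx t; rewrite chi_tensor_sum => /kerG[y ->].
  by rewrite raddfD /= !tensor_sum_ker// addr0.
move=> t u tu; apply/eqP; rewrite -subr_eq0; apply/eqP/inj0.
by rewrite [LHS]linearB; apply/eqP; rewrite subr_eq0; apply/eqP.
Qed.

End RelativeDuality.

Theorem theorem3p1p1 (R : comPzRingType) (A : pzAlgType R)
    (hR : noetherian R) (hA : fg_proj (restr A^o))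
    (Q : lmodType A) (hQ : fin_gen Q) (hQR : fg_proj (restr Q))
    (hQQ : fg_proj (homR Q Q))
    (M : lmodType A) (hM : fin_gen M) (hMR : fg_proj (restr M)) :
  (surj (chi Q M) <->
    (1%:Z%:E <= domdim (dual Q : lmodType A^c) (dual M : lmodType A^c))%E) /\
  (lin_iso (chi Q M : {linear tensor_hom Q M -> M}) <->
    (2%:Z%:E <= domdim (dual Q : lmodType A^c) (dual M : lmodType A^c))%E).
Proof.
have bQ := fg_proj_dual_basis hQR; have bM := fg_proj_dual_basis hMR.
have [n [G [_ G_approx0]]] := ker_right_approx hR (\0 : {linear M -> M}) hQ bM.
have {}G_approx (g : {linear Q -> M}) := G_approx0 g (fun=> erefl).
have surjP : surj (chi Q M) <-> has_mono_approx
    (dual Q : lmodType A^c) (dual M : lmodType A^c).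
  split=> [chi_surj|]; last exact: mono_approx_chi_surj.
  have [s Gs] := chi_surj_section bM G_approx chi_surj.
  exists (dual {ffun 'I_n -> Q}), (dual_map G); split.
    exact: dual_map_left_approx.
  by exists (dual_restr_map s); exact: dual_map_retract.
split; first by rewrite le1_domdim.
rewrite le_domdim//; split=> [[g [chiK gK]]|[/surjP chi_surj]].
  have chi_surj : surj (chi Q M) by move=> x; exists (g x); exact: gK.
  have [m [W [GW W_approx]]] := ker_right_approx hR G hQ (dual_basis_ffun n bQ).
  split; first exact/surjP.
  apply: (chi_inj_coresolution2 bQ bM G_approx GW W_approx chi_surj).
  exact: can_inj chiK.
by move=> /(coresolution2_chi_inj bQ bM) chi_inj; exact: lin_iso_of_bij.
Qed.
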